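(* For every integer $n\ge 2$, the following identity holds in $\mathbb{Z}[[z_0,\ldots,z_n]]$: \[ \sum_{k \ge 0 } \prod_{j=1}^n [k+1]_{ z_j } \, z_0^k = \sum_{\pi\in S_n} \sum_{(\rho,\epsilon)\in I_{2,n}^*} \frac{\displaystyle \prod_{j\in \mathrm{Des}(\pi)} z_0z_{\pi(1)}z_{\pi(2)}\cdots z_{\pi(j)} \prod_{j\in \mathrm{Neg}((\rho,\epsilon)^{-1})\setminus \{1\}} z_0z_{\pi(1)}z_{\pi(2)}\cdots z_{\pi(j-1)} }{\displaystyle (1-z_0)(1-z_0z_{\pi(1)}\cdots z_{\pi(n)})\prod_{j=1}^{n-1} \left(1-z_0^2z_{\pi(1)}^2\cdots z_{\pi(j)}^2 \right) } \, . \]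
   Context: $[m]_z=1+z+\cdots+z^{m-1}$; $\mathrm{Des}(\pi)=\{j\in[n-1]:\pi(j)>\pi(j+1)\}$ for $\pi\in S_n$. $B_n$ is the set of signed permutations $(\pi,\epsilon)$, $\pi\in S_n$, $\epsilon\in\{\pm1\}^n$, identified with the $n\times n$ matrix with entry $\epsilon_i$ at position $(\pi(i),i)$ and zeros elsewhere (group operation = matrix multiplication); window notation $[\epsilon_1\pi(1)\cdots\epsilon_n\pi(n)]$. Order $[-n,n]\setminus\{0\}$ by $-1<-2<\cdots<-n<1<\cdots<n$. $I_{2,n}$ is the set of $(\rho,\epsilon)\in B_n$ with $\epsilon_i\rho(i)<\epsilon_{i+1}\rho(i+1)$ in this order for all $i\in[n-1]$, and $I_{2,n}^*$ is the subset with $\epsilon_1\epsilon_2\cdots\epsilon_n=1$. For $(\rho,\epsilon)\in B_n$, $\mathrm{Neg}((\rho,\epsilon)^{-1})$ is the set of positions $j$ at which the window of $(\rho,\epsilon)^{-1}$ has a negative sign; equivalently $\mathrm{Neg}((\rho,\epsilon)^{-1})=\{\rho(i):\epsilon_i=-1\}$. *)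

(* Defs.v *)
From HB Require Import structures.
From mathcomp Require Import all_boot all_order all_fingroup all_algebra.
From mathcomp Require Import boolp.
From mathcomp Require Import mpoly.

Set Implicit Arguments.
Unset Strict Implicit.
Unset Printing Implicit Defensive.

Import Order.TTheory GRing.Theory Num.Theory.
Local Open Scope ring_scope.

(* Formal power series R[[z_0, ..., z_(n-1)]], as families of coefficients
   indexed by the exponent vectors 'X_{1..n} of the multinomials library. *)

Record mps (n : nat) (R : Type) := MPS { mps_coef :> 'X_{1..n} -> R }.

Notation "{ 'mps' R [ n ] }" := (mps n R)
  (at level 0, R, n at level 2, format "{ 'mps'  R [ n ] }") : type_scope.

HB.instance Definition _ n R := gen_eqMixin {mps R[n]}.
HB.instance Definition _ n R := gen_choiceMixin {mps R[n]}.

Lemma mpsP n R (f g : {mps R[n]}) : f =1 g -> f = g.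
Proof. by case: f g => [f] [g] /= /funext ->. Qed.

Section Zmodule.
Variables (n : nat) (R : zmodType).
Implicit Types f g h : {mps R[n]}.

Definition mps_zero : {mps R[n]} := MPS (fun=> 0).
Definition mps_opp f : {mps R[n]} := MPS (fun m => - f m).
Definition mps_add f g : {mps R[n]} := MPS (fun m => f m + g m).

Fact mps_addA : associative mps_add.
Proof. by move=> f g h; apply: mpsP => m /=; rewrite addrA. Qed.
Fact mps_addC : commutative mps_add.
Proof. by move=> f g; apply: mpsP => m /=; rewrite addrC. Qed.
Fact mps_add0 : left_id mps_zero mps_add.
Proof. by move=> f; apply: mpsP => m /=; rewrite add0r. Qed.
Fact mps_addN : left_inverse mps_zero mps_opp mps_add.
Proof. by move=> f; apply: mpsP => m /=; rewrite addNr. Qed.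

HB.instance Definition _ := GRing.isZmodule.Build {mps R[n]}
  mps_addA mps_addC mps_add0 mps_addN.

Lemma mps_coef0 m : (0 : {mps R[n]}) m = 0. Proof. by []. Qed.
Lemma mps_coefN f m : (- f) m = - f m. Proof. by []. Qed.
Lemma mps_coefD f g m : (f + g) m = f m + g m. Proof. by []. Qed.
Lemma mps_coefB f g m : (f - g) m = f m - g m. Proof. by []. Qed.
Lemma mps_coef_sum I (r : seq I) (P : pred I) (F : I -> {mps R[n]}) m :
  (\sum_(i <- r | P i) F i) m = \sum_(i <- r | P i) F i m.
Proof. exact: (big_morph (fun f : {mps R[n]} => f m)). Qed.
End Zmodule.

Section Ring.
Variables (n : nat) (R : comNzRingType).
Implicit Types f g h : {mps R[n]}.

Definition mps_one : {mps R[n]} := MPS (fun m => (m == 0%MM)%:R).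

(* Cauchy product; the degree bounds only make the index type finite. *)
Definition mps_mul f g : {mps R[n]} := MPS (fun m =>
  \sum_(k : 'X_{1..n < (mdeg m).+1, (mdeg m).+1} | m == (k.1 + k.2)%MM)
     f k.1 * g k.2).

(* The terms of f of degree < d, as a polynomial. *)
Definition mps_trunc (d : nat) f : {mpoly R[n]} :=
  \sum_(m : 'X_{1..n < d}) f m *: 'X_[m].

Lemma mps_truncE d f m : (mdeg m < d)%N -> (mps_trunc d f)@_m = f m.
Proof. exact: mcoeff_mpoly. Qed.

Lemma mps_mulE (p q : {mpoly R[n]}) d f g m : (mdeg m < d)%N ->
    (forall m', (mdeg m' < d)%N -> p@_m' = f m') ->
    (forall m', (mdeg m' < d)%N -> q@_m' = g m') ->
  mps_mul f g m = (p * q)@_m.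
Proof.
move=> md fp gq; rewrite mcoeffM; apply: eq_bigr => -[[k1 h1] [k2 h2]] /= _.
by rewrite fp ?gq // (leq_trans _ md).
Qed.

Lemma mps_trunc_mul d f g m : (mdeg m < d)%N ->
  mps_mul f g m = (mps_trunc d f * mps_trunc d g)@_m.
Proof. by move=> md; apply: mps_mulE md _ _ => m' ?; rewrite mps_truncE. Qed.

Fact mps_mulC : commutative mps_mul.
Proof.
by move=> f g; apply: mpsP => m; rewrite !(mps_trunc_mul _ _ (ltnSn _)) mulrC.
Qed.

Fact mps_mulA : associative mps_mul.
Proof.
move=> f g h; apply: mpsP => m; set d := (mdeg m).+1.
rewrite (@mps_mulE (mps_trunc d f) (mps_trunc d g * mps_trunc d h) d) //.
- rewrite (@mps_mulE (mps_trunc d f * mps_trunc d g) (mps_trunc d h) d) //.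
  + by rewrite mulrA.
  + by move=> m' md; rewrite -mps_trunc_mul.
  + by move=> m' md; rewrite mps_truncE.
- by move=> m' md; rewrite mps_truncE.
- by move=> m' md; rewrite -mps_trunc_mul.
Qed.

Fact mps_mul1 : left_id mps_one mps_mul.
Proof.
move=> f; apply: mpsP => m; set d := (mdeg m).+1.
rewrite (@mps_mulE 1 (mps_trunc d f) d) // ?mul1r ?mps_truncE //.
- by move=> m' _; rewrite mcoeff1.
- by move=> m' md; rewrite mps_truncE.
Qed.

Fact mps_mulDl : left_distributive mps_mul +%R.
Proof.
move=> f g h; apply: mpsP => m; rewrite mps_coefD /= -big_split /=.
by apply: eq_bigr => k _; rewrite mulrDl.
Qed.

Fact mps_one_neq0 : mps_one != 0.
Proof.
apply/eqP => /(congr1 (fun f : {mps R[n]} => f 0%MM)) /eqP.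
by rewrite /= eqxx oner_eq0.
Qed.

HB.instance Definition _ := GRing.Zmodule_isComNzRing.Build {mps R[n]}
  mps_mulA mps_mulC mps_mul1 mps_mulDl mps_one_neq0.

Lemma mps_coef1 m : (1 : {mps R[n]}) m = (m == 0%MM)%:R. Proof. by []. Qed.
Lemma mps_coefM f g m : (f * g) m =
  \sum_(k : 'X_{1..n < (mdeg m).+1, (mdeg m).+1} | m == (k.1 + k.2)%MM)
     f k.1 * g k.2.
Proof. by []. Qed.

Definition mpsC (c : R) : {mps R[n]} := MPS (fun m => c *+ (m == 0%MM)).

Definition mpsX (i : 'I_n) : {mps R[n]} := MPS (fun m => (m == U_(i)%MM)%:R).

Lemma mps_coefM0 f g : (f * g) 0%MM = f 0%MM * g 0%MM.
Proof.
have b0 (k : 'X_{1..n < (mdeg (0%MM : 'X_{1..n})).+1}) : (k : 'X_{1..n}) = 0%MM.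
  by case: k => k /=; rewrite mdeg0 ltnS leqn0 mdeg_eq0 => /eqP.
rewrite mps_coefM (big_pred1 (bm0, bm0)) // => -[k1 k2] /=.
by rewrite !b0 addm0 eqxx; apply/esym/eqP; congr (_, _); apply: val_inj; exact: b0.
Qed.

Lemma mps_coefCM c f m : (mpsC c * f) m = c * f m.
Proof.
set d := (mdeg m).+1.
have -> : (mpsC c * f) m = (c%:MP * mps_trunc d f)@_m.
  apply: (@mps_mulE _ _ d) => // m' md; last by rewrite mps_truncE.
  by rewrite mcoeffC /= mulr_natr.
by rewrite mcoeffCM mps_truncE.
Qed.

Lemma mps_coefM_small f g d e m : (mdeg m < d + e)%N ->
    (forall m', (mdeg m' < d)%N -> f m' = 0) ->
    (forall m', (mdeg m' < e)%N -> g m' = 0) ->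
  (f * g) m = 0.
Proof.
move=> md f0 g0; rewrite mps_coefM big1 // => -[[k1 h1] [k2 h2]] /= /eqP Em.
have [/f0 ->|dk1] := ltnP (mdeg k1) d; first by rewrite mul0r.
rewrite g0 ?mulr0 // -(ltn_add2l d); apply: leq_trans md.
by rewrite Em mdegD ltnS leq_add2r.
Qed.

Lemma mps_coefX_small f k m : f 0%MM = 0 -> (mdeg m < k)%N -> (f ^+ k) m = 0.
Proof.
move=> f0; elim: k m => // k IHk m mk; rewrite exprS.
apply: (@mps_coefM_small _ _ 1 k) => // m'.
by rewrite ltnS leqn0 mdeg_eq0 => /eqP ->.
Qed.

(* u_0 + u_1 + ... = s: the partial sums converge to s coefficientwise,
   each coefficient being eventually constant. *)
Definition mps_sums_to (u : nat -> {mps R[n]}) (s : {mps R[n]}) : Prop :=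
  forall m : 'X_{1..n}, exists N : nat, forall K : nat, (N <= K)%N ->
    (\sum_(k < K) u k) m = s m.

End Ring.

Section UnitRing.
Variables (n : nat) (R : comUnitRingType).
Implicit Types f g h : {mps R[n]}.

Definition mps_unit : pred {mps R[n]} :=
  fun f => f 0%MM \is a GRing.unit.

(* With c = f(0), 1/f is c^-1 times the geometric series in 1 - c^-1 f, whose
   k-th term only has monomials of degree at least k. *)
Definition mps_inv f : {mps R[n]} :=
  if mps_unit f then
    let c := (f 0%MM)^-1 in
    MPS (fun m => c * (\sum_(k < (mdeg m).+1) (1 - mpsC n c * f) ^+ k) m)
  else f.

Fact mps_mulV : {in mps_unit, left_inverse 1 mps_inv *%R}.
Proof.
move=> f; rewrite unfold_in => uf; rewrite /mps_inv /mps_unit uf.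
set c := (f 0%MM)^-1; set h := 1 - _; set g := MPS _.
have h0 : h 0%MM = 0.
  by rewrite mps_coefB mps_coef1 mps_coefCM eqxx mulVr ?subrr.
apply: mpsP => m; set d := (mdeg m).+1.
have -> : (g * f) m = (mpsC n c * (\sum_(k < d) h ^+ k) * f) m.
  rewrite !mps_coefM; apply: eq_bigr => -[[k1 h1] [k2 h2]] _.
  congr (_ * _); rewrite [RHS]mps_coefCM /=; congr (_ * _); rewrite !mps_coef_sum.
  rewrite -(big_mkord xpredT (fun i => (h ^+ i) k1)).
  rewrite -(big_mkord xpredT (fun i => (h ^+ i) k1)).
  rewrite [RHS](big_cat_nat (n := (mdeg k1).+1)) //= [X in _ + X]big_nat_cond.
  rewrite [X in _ + X]big1 ?addr0 // => i; rewrite andbT => /andP[ki _].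
  exact: mps_coefX_small.
rewrite mulrAC -[mpsC n c * f](subKr 1) -/h.
rewrite -opprB mulNr -subrX1 opprB mps_coefB mps_coefX_small ?subr0 //.
Qed.

Fact mps_unitP f g : g * f = 1 -> mps_unit f.
Proof.
move/(congr1 (fun h : {mps R[n]} => h 0%MM)); rewrite mps_coefM0 => fg.
apply/unitrPr; exists (g 0%MM); rewrite mulrC fg mps_coef1 eqxx //.
Qed.

Fact mps_inv_out : {in [predC mps_unit], mps_inv =1 id}.
Proof. by move=> f; rewrite inE unfold_in /mps_inv /mps_unit => /negbTE ->. Qed.

HB.instance Definition _ := GRing.ComNzRing_hasMulInverse.Build {mps R[n]}
  mps_mulV mps_unitP mps_inv_out.

Lemma mps_unitE f : (f \is a GRing.unit) = (f 0%MM \is a GRing.unit).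
Proof. by []. Qed.
End UnitRing.

(* [m]_z *)
Definition qint (R : pzSemiRingType) (m : nat) (z : R) : R :=
  \sum_(i < m) z ^+ i.

(* Positions and values in {1, ..., n} are encoded by 'I_n, shifted by one:
   i : 'I_n stands for i + 1. *)

Definition Des (n : nat) (s : 'S_n) : {set 'I_n} :=
  [set i : 'I_n | [exists j : 'I_n, (j == i.+1 :> nat) && (s j < s i)%N]].

(* The sign bit sp_neg i is true when epsilon_i = -1. *)
Record signed_perm (n : nat) :=
  SignedPerm { sp_perm : 'S_n; sp_neg : {ffun 'I_n -> bool} }.

Section SignedPermutations.
Variable n : nat.
Implicit Types u v w : signed_perm n.

Definition sp_pair w := (sp_perm w, sp_neg w).
Definition pair_sp (p : 'S_n * {ffun 'I_n -> bool}) := SignedPerm p.1 p.2.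
Fact sp_pairK : cancel sp_pair pair_sp. Proof. by case. Qed.

HB.instance Definition _ := Finite.copy (signed_perm n) (can_type sp_pairK).

Definition sp_sign w (i : 'I_n) : int := (-1) ^+ sp_neg w i.

Definition sp_mx w : 'M[int]_n :=
  \matrix_(r, i) (if r == sp_perm w i then sp_sign w i else 0).

(* Permutations compose from left to right in MathComp, so the permutation of
   the matrix product of u and v is sp_perm v * sp_perm u; see sp_mxM. *)
Definition sp_mul u v : signed_perm n :=
  SignedPerm (sp_perm v * sp_perm u)%g
    [ffun i => sp_neg u (sp_perm v i) (+) sp_neg v i].
Definition sp_one : signed_perm n := SignedPerm 1%g [ffun=> false].
Definition sp_inv w : signed_perm n :=
  SignedPerm (sp_perm w)^-1%g [ffun j => sp_neg w ((sp_perm w)^-1%g j)].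

Lemma sp_eqP u v :
  sp_perm u = sp_perm v -> sp_neg u =1 sp_neg v -> u = v.
Proof. by case: u v => [p e] [q f] /= -> /ffunP ->. Qed.

Fact sp_mulA : associative sp_mul.
Proof.
move=> u v w; apply: sp_eqP => /= [|i]; first by rewrite mulgA.
by rewrite !ffunE permM addbA.
Qed.
Fact sp_mul1 : left_id sp_one sp_mul.
Proof.
by move=> u; apply: sp_eqP => /= [|i]; rewrite ?mulg1 ?ffunE.
Qed.
Fact sp_mulV : left_inverse sp_one sp_inv sp_mul.
Proof.
move=> u; apply: sp_eqP => /= [|i]; first by rewrite mulgV.
by rewrite !ffunE permK addbb.
Qed.

HB.instance Definition _ := Finite_isGroup.Build (signed_perm n)
  sp_mulA sp_mul1 sp_mulV.

Lemma sp_mxM u v : sp_mx (u * v)%g = sp_mx u *m sp_mx v.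
Proof.
apply/matrixP => r i; rewrite !mxE (bigD1 (sp_perm v i)) //= !mxE eqxx.
rewrite big1 ?addr0 => [|j /negbTE ne]; last by rewrite !mxE ne mulr0.
rewrite permM /sp_sign ffunE signr_addb.
by case: eqP => _; rewrite ?mul0r.
Qed.

Lemma sp_mx_inj : injective sp_mx.
Proof.
move=> u v /matrixP Euv; apply: sp_eqP => [|i].
  apply/permP => i; have := Euv (sp_perm u i) i; rewrite !mxE eqxx.
  by case: eqP => // _ /eqP; rewrite signr_eq0.
have := Euv (sp_perm u i) i; rewrite !mxE eqxx.
case: eqP => _ /eqP; last by rewrite signr_eq0.
by rewrite /sp_sign; do 2!case: (sp_neg _ i).
Qed.

Definition window w (i : 'I_n) : int := sp_sign w i * (sp_perm w i).+1%:Z.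

Definition Neg w : {set 'I_n} := [set i | window w i < 0].

Lemma mem_Neg w i : (i \in Neg w) = sp_neg w i.
Proof.
by rewrite inE /window /sp_sign; case: (sp_neg w i); rewrite ?mulN1r ?mul1r.
Qed.

Lemma NegV w : Neg w^-1%g = sp_perm w @: [set i | sp_neg w i].
Proof.
apply/setP => j; rewrite mem_Neg ffunE; apply/idP/imsetP => [wj|[i]].
  by exists ((sp_perm w)^-1%g j); rewrite ?inE // permKV.
by rewrite inE => wi ->; rewrite permK.
Qed.

(* On nonzero integers, the order -1 < -2 < -3 < ... < 1 < 2 < 3 < ... *)
Definition window_lt (a b : int) : bool :=
  if a < 0 then (0 < b) || (b < a) else a < b.

Definition I2 : {set signed_perm n} :=
  [set w | [forall i : 'I_n, forall j : 'I_n,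
     (j == i.+1 :> nat) ==> window_lt (window w i) (window w j)]].

Definition I2star : {set signed_perm n} :=
  [set w in I2 | \prod_(i < n) sp_sign w i == 1].

End SignedPermutations.

(* The variables z_0, z_1, ..., z_n of Z[[z_0, ..., z_n]]; the encoded index
   i : 'I_n stands for i + 1, whence the lift. *)
Definition z0 (n : nat) : {mps int[n.+1]} := mpsX int ord0.
Definition zvar (n : nat) (i : 'I_n) : {mps int[n.+1]} := mpsX int (lift ord0 i).

(* z_0 z_{s(1)} z_{s(2)} ... z_{s(k)} *)
Definition zprefix (n : nat) (s : 'S_n) (k : nat) : {mps int[n.+1]} :=
  z0 n * \prod_(i < n | (i < k)%N) zvar (s i).

Lemma zprefix_coef0 (n : nat) (s : 'S_n) (k : nat) : zprefix s k 0%MM = 0.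
Proof.
rewrite mps_coefM0 /=; case: eqP => [/(congr1 mdeg)|_]; last by rewrite mul0r.
by rewrite mdeg0 mdeg1.
Qed.

Lemma zdenom_unit (n : nat) (s : 'S_n) :
  (1 - z0 n) * (1 - zprefix s n) * \prod_(1 <= j < n) (1 - zprefix s j ^+ 2)
    \is a GRing.unit.
Proof.
have z00 : z0 n 0%MM = 0.
  by have := zprefix_coef0 s 0; rewrite /zprefix big_pred0 ?mulr1.
have un (f : {mps int[n.+1]}) : f 0%MM = 0 -> 1 - f \is a GRing.unit.
  by move=> f0; rewrite mps_unitE mps_coefB f0 subr0 mps_coef1 eqxx unitr1.
rewrite !unitrM !un ?zprefix_coef0 //= rpred_prod // => j _.
by rewrite un // mps_coefM0 zprefix_coef0 mul0r.
Qed.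

(* Main.v *)
Require Import Defs.
From HB Require Import structures.
From mathcomp Require Import all_boot all_order all_fingroup all_algebra.
From mathcomp Require Import mpoly zify.

Set Implicit Arguments.
Unset Strict Implicit.
Unset Printing Implicit Defensive.

Import Order.TTheory GRing.Theory Num.Theory.
Local Open Scope ring_scope.

(** Write x_k = z_0 z_{s(1)} ... z_{s(k)}. An element of I_{2,n} is determined
    by the set A of absolute values carrying a minus sign, and any A occurs;
    A has even size for I_{2,n}^*, and 1 contributes a factor 1, so
    summing over (rho, epsilon) gives the product of the 1 + x_j, 1 <= j < n. The
    summand of s thus becomes \prod_(j in Des s) x_j / \prod_(0 <= k <= n) (1 - x_k),
    which is the generating series of the exponents a with
    a_0 >= a_{s(1)} >= ... >= a_{s(n)}, strictly at the descents of s. Each a with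
    all a_j <= a_0 is sorted in this way by exactly one s. *)

(** * Permutations sorting a total order *)

Definition sorting_perm n (r : rel 'I_n) (s : 'S_n) : bool :=
  [forall i : 'I_n, forall j : 'I_n, (j == i.+1 :> nat) ==> r (s i) (s j)].

Lemma sorting_permP n (r : rel 'I_n) (s : 'S_n) :
  reflect (forall i j : 'I_n, j = i.+1 :> nat -> r (s i) (s j))
          (sorting_perm r s).
Proof.
apply: (iffP idP) => [/forallP sr i j ij | sr].
  by move/forallP/(_ j)/implyP: (sr i); apply; apply/eqP.
by apply/forallP => i; apply/forallP => j; apply/implyP => /eqP; apply: sr.
Qed.

Lemma sorting_permE n (r : rel 'I_n) (s : 'S_n) :
  sorting_perm r s = sorted r [seq s i | i <- enum 'I_n].
Proof.
case: n r s => [|n] r s.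
  rewrite (size0nil (size_enum_ord 0)); apply/sorting_permP => -[//].
have E i : (i < n.+1)%N -> nth ord0 [seq s i | i <- enum 'I_n.+1] i = s (inord i).
  move=> lin; rewrite (nth_map ord0) ?size_enum_ord //; congr (s _).
  by apply: val_inj; rewrite /= nth_enum_ord // inordK.
apply/sorting_permP/(sortedP ord0); rewrite size_map size_enum_ord => H i.
  by move=> lin; rewrite !E ?(ltnW lin) //; apply: H; rewrite !inordK // ltnW.
move=> j ij; have jn := ltn_ord j; rewrite ij in jn.
have := H i jn; rewrite !E ?(ltnW jn) // inord_val.
by rewrite -ij inord_val.
Qed.

(** All one-line words of permutations are rearrangements of one list, and by antisymmetry that list
    has a single sorted rearrangement. This is used both to order the window for a given set of
    signs and to order an exponent vector. *)
Lemma sorting_perm_exists_unique n (r : rel 'I_n) :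
    total r -> transitive r -> antisymmetric r ->
  exists s : 'S_n, forall t, sorting_perm r t = (t == s).
Proof.
move=> rT rt ra; pose L := sort r (enum 'I_n).
have sL : size L == n by rewrite size_sort size_enum_ord.
have uL : uniq L by rewrite sort_uniq enum_uniq.
have injL : injective (tnth (Tuple sL)) by apply/tuple_uniqP.
have permL (t : 'S_n) : perm_eq [seq t i | i <- enum 'I_n] L.
  rewrite perm_sym perm_sort; apply: uniq_perm.
  - exact: enum_uniq.
  - by rewrite map_inj_uniq ?enum_uniq //; apply: perm_inj.
  - move=> i; rewrite mem_enum; apply/esym/mapP.
    by exists (t^-1%g i); rewrite ?mem_enum ?permKV.
exists (perm injL) => t; rewrite sorting_permE; apply/idP/eqP => [st | ->].
  have tL : [seq t i | i <- enum 'I_n] = L.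
    by apply: (sorted_eq rt ra) => //; exact: sort_sorted.
  apply/permP => i; rewrite permE (tnth_nth i) /= -tL.
  rewrite (nth_map i) ?size_enum_ord //; congr (t _).
  by apply: val_inj; rewrite /= nth_enum_ord.
suff -> : [seq perm injL i | i <- enum 'I_n] = L by apply: sort_sorted.
rewrite (eq_map (g := tnth (Tuple sL))); last by move=> i; rewrite permE.
exact: (map_tnth_enum (Tuple sL)).
Qed.

(** * Monomials as power series *)

Definition mps_mono n (R : comNzRingType) (m : 'X_{1..n}) : {mps R[n]} :=
  MPS (fun m' => (m' == m)%:R).

Section Monomials.
Variables (n : nat) (R : comNzRingType).
Implicit Types (f : {mps R[n]}) (m : 'X_{1..n}).
Local Notation mono := (mps_mono R).

Lemma mps_coefM_mono f m a :
  (f * mono m) a = if (m <= a)%MM then f (a - m)%MM else 0.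
Proof.
rewrite mps_coefM; case: ifP => [ma | /negbT ma]; last first.
  apply: big1 => -[k1 k2] /= /eqP E; case: eqP => [E2|]; last by rewrite mulr0.
  case/negP: ma; rewrite E E2; apply/mnm_lepP => i.
  by rewrite mnmDE leq_addl.
have lt1 : (mdeg (a - m)%MM < (mdeg a).+1)%N.
  by rewrite ltnS -{2}(submK ma) mdegD leq_addr.
have lt2 : (mdeg m < (mdeg a).+1)%N.
  by rewrite ltnS -{1}(submK ma) mdegD leq_addl.
rewrite (bigD1 (BMultinom lt1, BMultinom lt2)) /=; last by rewrite submK.
rewrite eqxx mulr1 big1 ?addr0 // => -[k1 k2] /= /andP[/eqP E ne].
case: eqP => [E2|]; last by rewrite mulr0.
case/negP: ne; apply/eqP; congr (_, _); apply: val_inj => //=.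
by rewrite -E2 [X in (X - _)%MM]E addmK.
Qed.

Lemma mps_mono0 : mono (0%MM : 'X_{1..n}) = 1.
Proof. exact: mpsP. Qed.

Lemma mps_monoD m1 m2 : mono (m1 + m2)%MM = mono m1 * mono m2.
Proof.
apply: mpsP => a; rewrite mps_coefM_mono /=.
case: ifP => [ma | /negbT ma].
  congr (nat_of_bool _)%:R; apply/eqP/eqP => [->|<-]; last by rewrite submK.
  by rewrite addmK.
case: eqP => // E; case/negP: ma; rewrite E; apply/mnm_lepP => i.
by rewrite mnmDE leq_addl.
Qed.

Lemma mps_mono_sum I (r : seq I) (P : pred I) (F : I -> 'X_{1..n}) :
  mono (\sum_(i <- r | P i) F i)%MM = \prod_(i <- r | P i) mono (F i).
Proof. exact: (big_morph mono mps_monoD mps_mono0). Qed.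

Lemma mps_mono_muln m k : mono (m *+ k)%MM = mono m ^+ k.
Proof.
elim: k => [|k IH]; first by rewrite mulm0n mps_mono0.
by rewrite mulmS mps_monoD IH exprS.
Qed.

End Monomials.

(** * Coefficients of the left-hand side *)

Section BoxSeries.
Variable n : nat.

Definition box (a : 'X_{1..n.+1}) : bool :=
  [forall i : 'I_n, a (lift ord0 i) <= a ord0]%N.

Lemma coef_qint_prod (k : nat) (a : 'X_{1..n.+1}) :
  (\prod_(j < n) qint k.+1 (zvar j) * z0 n ^+ k) a = ((k == a ord0) && box a)%:R.
Proof.
(* [M f] is the exponent of the term that takes the power [f j] from the factor of index [j]. It
   determines [f], so no monomial occurs twice. *)
pose M (f : {ffun 'I_n -> 'I_k.+1}) : 'X_{1..n.+1} :=
  (\sum_j U_(lift ord0 j) *+ f j + U_(ord0) *+ k)%MM.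
have -> : \prod_(j < n) qint k.+1 (zvar j) * z0 n ^+ k =
    \sum_(f : {ffun 'I_n -> 'I_k.+1}) mps_mono int (M f).
  rewrite /qint bigA_distr_bigA big_distrl /=; apply: eq_bigr => f _.
  rewrite /M mps_monoD mps_mono_sum mps_mono_muln; congr (_ * _).
  by apply: eq_bigr => j _; rewrite mps_mono_muln.
have M0 f : M f ord0 = k.
  rewrite mnmDE mnm_sumE big1 ?add0n.
    by rewrite mulmnE mnm1E eqxx mul1n.
  by move=> j _; rewrite mulmnE mnm1E.
have Mlift f j : M f (lift ord0 j) = f j.
  rewrite mnmDE mnm_sumE (bigD1 j) //= big1 ?addn0.
    by rewrite !mulmnE !mnm1E eqxx mul1n addn0.
  move=> i /negbTE ij; rewrite mulmnE mnm1E.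
  by rewrite (inj_eq (@lift_inj _ _)) ij.
rewrite mps_coef_sum; case: (boolP (_ && _)) => [/andP[/eqP ka /forallP ba]|nba].
  pose f0 := [ffun j => inord (a (lift ord0 j)) : 'I_k.+1].
  have E0 : a = M f0.
    apply/mnmP => i; case: (unliftP ord0 i) => [j|] ->; last by rewrite M0.
    by rewrite Mlift ffunE inordK // ltnS ka; apply: ba.
  rewrite (bigD1 f0) //= {1}E0 eqxx big1 ?addr0 // => f ne.
  case: eqP => // E; case/eqP: ne; apply/ffunP => j; apply: val_inj => /=.
  by rewrite -Mlift -E E0 Mlift.
apply: big1 => f _ /=; case: eqP => // E; case/negP: nba.
rewrite E M0 eqxx; apply/forallP => j; rewrite M0 Mlift.
by rewrite -ltnS.
Qed.

End BoxSeries.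

(** * Cones of exponents with bounded or prescribed successive differences *)

Section CompositionCone.
Variables (n : nat) (s : 'S_n).
Implicit Types a : 'X_{1..n.+1}.

(* The exponents a_0, a_{s(1)}, ..., a_{s(n)}, continued by 0. *)
Definition expo a (k : nat) : nat :=
  if k is k'.+1 then if insub k' is Some i then a (lift ord0 (s i)) else 0%N
  else a ord0.

Definition prefix_mnm (m : nat) : 'X_{1..n.+1} :=
  (U_(ord0) + \sum_(i < n | (i < m)%N) U_(lift ord0 (s i)))%MM.

Lemma expoS a (i : 'I_n) : expo a i.+1 = a (lift ord0 (s i)).
Proof. by rewrite /expo valK. Qed.

Lemma expo_out a k : (n < k)%N -> expo a k = 0%N.
Proof. by case: k => // k nk; rewrite /expo insubF // ltnNge -ltnS nk. Qed.

Lemma expoD a1 a2 k : expo (a1 + a2)%MM k = (expo a1 k + expo a2 k)%N.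
Proof. by case: k => [|k] /=; [|case: insub => [i|] //]; rewrite mnmDE. Qed.

Lemma expo0 k : expo 0%MM k = 0%N.
Proof. by case: k => [|k] /=; [|case: insub => [i|] //]; rewrite mnm0E. Qed.

Lemma expo_sum I (r : seq I) (P : pred I) (F : I -> 'X_{1..n.+1}) k :
  expo (\sum_(i <- r | P i) F i)%MM k = (\sum_(i <- r | P i) expo (F i) k)%N.
Proof. exact: (big_morph (expo^~ k) (fun x y => expoD x y k) (expo0 k)). Qed.

Lemma expo_prefix m k : (m <= n)%N -> expo (prefix_mnm m) k = (k <= m)%N.
Proof.
move=> mn; case: k => [|k].
  rewrite /= mnmDE mnm1E eqxx mnm_sumE big1 // => i _.
  by rewrite mnm1E.
have [kn|nk] := ltnP k n; last by rewrite expo_out // leqNgt (leq_ltn_trans mn).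
rewrite (expoS _ (Ordinal kn)) mnmDE mnm1E /= add0n mnm_sumE big_mkcond.
rewrite (bigD1 (Ordinal kn)) //= big1 ?addn0 => [|i /negbTE ik].
  by rewrite mnm1E eqxx; case: ltnP.
by case: ifP => // _; rewrite mnm1E (inj_eq (@lift_inj _ _)) (inj_eq perm_inj) ik.
Qed.

Lemma expo_inj a1 a2 : (forall k, (k <= n)%N -> expo a1 k = expo a2 k) -> a1 = a2.
Proof.
move=> E; apply/mnmP => i; case: (unliftP ord0 i) => [j|] ->; last exact: (E 0%N).
by have := E (s^-1%g j).+1 (ltn_ord _); rewrite !expoS permKV.
Qed.

Lemma prefix_mnm_le m a : (m <= n)%N ->
  (forall k, (k <= m)%N -> (0 < expo a k)%N) -> (prefix_mnm m <= a)%MM.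
Proof.
move=> mn pos; apply/mnm_lepP => i.
case: (unliftP ord0 i) => [j|] ->.
  rewrite -[j](permKV s) -!expoS expo_prefix //.
  by case: leqP => // /pos.
by rewrite -!/(expo _ 0) expo_prefix // pos.
Qed.

Lemma zprefix_mono m : zprefix s m = mps_mono int (prefix_mnm m).
Proof. by rewrite mps_monoD mps_mono_sum. Qed.

(* Coordinates of the exponent in the basis [prefix_mnm] are the successive
   differences of [expo]: the first [m] are prescribed, the others only bounded. *)
Definition cone (d : nat -> nat) (m : nat) a : bool :=
  [forall k : 'I_n.+1, if (k < m)%N then expo a k == expo a k.+1 + d k
                       else expo a k.+1 + d k <= expo a k]%N.

Definition cone_series d m : {mps int[n.+1]} := MPS (fun a => (cone d m a)%:R).

Lemma coneP d m a :
  reflect (forall k, (k <= n)%N -> if (k < m)%N then expo a k = expo a k.+1 + d k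
                       else expo a k.+1 + d k <= expo a k)%N (cone d m a).
Proof.
apply: (iffP forallP) => H k; last first.
  by have := H k (ltn_ord k); case: ifP => // _ ->.
by rewrite -ltnS => kn; have := H (Ordinal kn) => /=; case: ifP => // _ /eqP.
Qed.

(** Subtracting [prefix_mnm m] lowers the difference of [expo] at [m] by one and keeps all others.
    It is possible when that difference exceeds [d m]; otherwise the difference is already [d m]. *)
Lemma cone_step d m a : (m <= n)%N ->
  cone d m a = (cone d m.+1 a || ((prefix_mnm m <= a)%MM && cone d m (a - prefix_mnm m)%MM)).
Proof.
move=> mn.
have shift : (prefix_mnm m <= a)%MM -> forall k,
    expo a k = (expo (a - prefix_mnm m)%MM k + (k <= m))%N.
  by move=> le k; rewrite -{1}(submK le) expoD expo_prefix.
apply/idP/orP => [/coneP C | [/coneP C | /andP[le /coneP C]]].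
- have [E|ne] := eqVneq (expo a m) (expo a m.+1 + d m)%N.
    left; apply/coneP => k kn; have := C k kn; rewrite ltnS.
    by case: (ltngtP k m) => // ->.
  right; have le : (prefix_mnm m <= a)%MM.
    (* The entry at [m] is positive because its difference is strictly above [d m]; positivity
       spreads down to 0 since [expo a] is weakly decreasing there. The induction is on [m - k], and
       truncated subtraction settles the steps past 0. *)
    apply: prefix_mnm_le => // k km; rewrite -(subKn km).
    elim: (m - k)%N => [|j IH].
      by rewrite subn0; have := C m mn; rewrite ltnn; lia.
    have [jm|mj] := ltnP j m; last by have <- : (m - j = m - j.+1)%N by lia.
    have := C (m - j.+1)%N; have -> : (m - j.+1 < m)%N by lia.
    have -> : (m - j.+1).+1 = (m - j)%N by lia.
    by move=> /(_ ltac:(lia)); lia.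
  rewrite le; apply/coneP => k kn; have := C k kn.
  have := shift le k; have := shift le k.+1.
  by case: (ltngtP k m) => [||E]; [lia|lia|subst k; lia].
- apply/coneP => k kn; have := C k kn; rewrite ltnS.
  by case: (ltngtP k m) => //; lia.
- apply/coneP => k kn; have := C k kn; have := shift le k; have := shift le k.+1.
  by case: (ltngtP k m); lia.
Qed.

Lemma cone_step_disjoint d m a : (m <= n)%N -> cone d m.+1 a ->
  (prefix_mnm m <= a)%MM -> ~~ cone d m (a - prefix_mnm m)%MM.
Proof.
move=> mn /coneP/(_ m mn) C le; apply/negP => /coneP/(_ m mn).
have := expoD (a - prefix_mnm m)%MM (prefix_mnm m) m.
have := expoD (a - prefix_mnm m)%MM (prefix_mnm m) m.+1.
by move: C; rewrite submK // !expo_prefix // leqnn ltnn; lia.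
Qed.

(** The subtracted product is the series of the second, disjoint alternative in [cone_step], so only
    exponents with the difference at [m] equal to [d m] remain. *)
Lemma cone_seriesM d m : (m <= n)%N ->
  cone_series d m * (1 - zprefix s m) = cone_series d m.+1.
Proof.
move=> mn; rewrite mulrBr mulr1 zprefix_mono; apply: mpsP => a.
rewrite mps_coefB mps_coefM_mono /= (cone_step d a mn).
have := @cone_step_disjoint d m a mn.
case: (cone d m.+1 a) => /= [/(_ isT)|_]; last by case: ifP => //= _; rewrite subrr.
by case: ifP => [_ /(_ isT)/negbTE -> | _ _]; rewrite subr0.
Qed.

Lemma cone_series_prod d m : (m <= n.+1)%N ->
  cone_series d 0 * \prod_(k < m) (1 - zprefix s k) = cone_series d m.
Proof.
elim: m => [|m IH] mn; first by rewrite big_ord0 mulr1.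
by rewrite big_ord_recr /= mulrA IH ?cone_seriesM // ltnW.
Qed.

(** With all differences prescribed and [expo] zero beyond [n], one exponent is left: the sum of the
    [prefix_mnm j.+1] for [j] in [A]. *)
Lemma cone_series_top (A : {set 'I_n}) :
  cone_series (fun k => \sum_(j in A) (k == j.+1)%N)%N n.+1
    = \prod_(j in A) zprefix s j.+1.
Proof.
pose D : 'X_{1..n.+1} := (\sum_(j in A) prefix_mnm j.+1)%MM.
have -> : \prod_(j in A) zprefix s j.+1 = mps_mono int D.
  by rewrite mps_mono_sum; apply: eq_bigr => j _; rewrite zprefix_mono.
apply: mpsP => a /=; congr (nat_of_bool _)%:R.
have DE k : expo D k = (\sum_(j in A) (k <= j.+1)%N)%N.
  by rewrite expo_sum; apply: eq_bigr => j _; rewrite expo_prefix.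
have DS k : expo D k = (expo D k.+1 + \sum_(j in A) (k == j.+1)%N)%N.
  rewrite !DE -big_split; apply: eq_bigr => j _ /=; lia.
apply/coneP/eqP => [C | -> k kn]; last by rewrite ltnS kn.
apply: expo_inj => k kn.
(* Descending induction from [n.+1], where both sequences vanish. *)
have [i ->] : exists i, k = (n.+1 - i)%N by exists (n.+1 - k)%N; lia.
elim: i => [|i IH]; first by rewrite subn0 !expo_out.
have [ni|i_n] := ltnP n i; first by have <- : (n.+1 - i = n.+1 - i.+1)%N by lia.
have := C (n.+1 - i.+1)%N; rewrite DS.
have -> : (n.+1 - i.+1 < n.+1)%N by lia.
have -> : (n.+1 - i.+1).+1 = (n.+1 - i)%N by lia.
by rewrite IH => ->; last lia.
Qed.

End CompositionCone.

(** * Elements of [I2star] as even subsets *)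

(** The reflexive window order carried over to absolute values, [A] being those with a minus
    sign. *)
Definition sign_rel n (A : {set 'I_n}) : rel 'I_n := fun i j =>
  if i \in A then (j \notin A) || (i <= j)%N else (j \notin A) && (i <= j)%N.

Lemma sign_rel_total n (A : {set 'I_n}) : total (sign_rel A).
Proof.
by move=> i j; rewrite /sign_rel; do 2!case: (_ \in A) => //=; apply: leq_total.
Qed.

Lemma sign_rel_trans n (A : {set 'I_n}) : transitive (sign_rel A).
Proof.
by move=> j i k; rewrite /sign_rel; do 3!case: (_ \in A) => //=; apply: leq_trans.
Qed.

Lemma sign_rel_anti n (A : {set 'I_n}) : antisymmetric (sign_rel A).
Proof.
move=> i j ij; apply/val_inj/anti_leq; move: ij; rewrite /sign_rel.
by do 2!case: (_ \in A) => //=; rewrite ?andbF.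
Qed.

Lemma mem_NegV n (w : signed_perm n) i :
  (sp_perm w i \in Neg w^-1%g) = sp_neg w i.
Proof. by rewrite mem_Neg ffunE permK. Qed.

Lemma window_ltE n (w : signed_perm n) (i j : 'I_n) : i != j ->
  window_lt (window w i) (window w j)
    = sign_rel (Neg w^-1%g) (sp_perm w i) (sp_perm w j).
Proof.
move=> ne; rewrite /sign_rel !mem_NegV /window_lt /window /sp_sign.
have {ne} : sp_perm w i != sp_perm w j :> nat by rewrite (inj_eq val_inj) (inj_eq perm_inj).
case: (sp_neg w i); case: (sp_neg w j) => /= ne; rewrite ?expr1 ?expr0 ?mulN1r ?mul1r; lia.
Qed.

Lemma mem_I2 n (w : signed_perm n) :
  (w \in I2 n) = sorting_perm (sign_rel (Neg w^-1%g)) (sp_perm w).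
Proof.
rewrite inE; apply: eq_forallb => i; apply: eq_forallb => j.
case: eqP => //= ij; apply: window_ltE; apply/eqP => /(congr1 val) /=; lia.
Qed.

Lemma prod_sp_sign n (w : signed_perm n) :
  \prod_(i < n) sp_sign w i = (-1) ^+ #|Neg w^-1%g|.
Proof.
rewrite NegV card_imset; last exact: perm_inj.
rewrite -prodr_const [RHS]big_mkcond; apply: eq_bigr => i _.
by rewrite inE /sp_sign; case: (sp_neg w i).
Qed.

Lemma mem_I2star n (w : signed_perm n) :
  (w \in I2star n) = (w \in I2 n) && ~~ odd #|Neg w^-1%g|.
Proof.
rewrite [LHS]inE prod_sp_sign -signr_odd; congr (_ && _).
by case: (odd _).
Qed.

(** Once [A] is fixed, the window must list the values in the total order [sign_rel A], and the
    signs are read off from membership in [A]. *)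
Lemma I2_Neg_unique n (A : {set 'I_n}) :
  exists w : signed_perm n, forall v, (v \in I2 n) && (Neg v^-1%g == A) = (v == w).
Proof.
have [s sP] := sorting_perm_exists_unique (@sign_rel_total _ A)
  (@sign_rel_trans _ A) (@sign_rel_anti _ A).
pose w := SignedPerm s [ffun i => s i \in A].
have wA : Neg w^-1%g = A.
  by apply/setP => j; rewrite mem_Neg !ffunE permKV.
exists w => v; apply/andP/eqP => [[] | ->]; last first.
  by rewrite mem_I2 wA sP eqxx.
rewrite mem_I2 => + /eqP vA; rewrite vA sP => /eqP vs; apply: sp_eqP => // i.
by rewrite !ffunE -vs -vA mem_NegV.
Qed.

Lemma sum_I2star n (V : nmodType) (f : {set 'I_n} -> V) :
  \sum_(w in I2star n) f (Neg w^-1%g) = \sum_(A : {set 'I_n} | ~~ odd #|A|) f A.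
Proof.
rewrite (partition_big (fun w => Neg w^-1%g) (fun A => ~~ odd #|A|)) /=; last first.
  by move=> w; rewrite mem_I2star => /andP[].
apply: eq_bigr => A eA; have [w wP] := I2_Neg_unique A.
rewrite (big_pred1 w) => [|v].
  by have := wP w; rewrite eqxx => /andP[_ /eqP ->].
rewrite /= -wP mem_I2star; case: eqP => [->|_]; by rewrite ?andbF ?eA ?andbT.
Qed.

(* Twice the even part of \prod (1 + y_i) is \prod (1 + y_i) + \prod (1 - y_i),
   and the second product vanishes as y_{i0} = 1. *)
Lemma sum_even_subsets (R : comNzRingType) (I : finType) (i0 : I) (y : I -> R) :
  y i0 = 1 ->
  (\sum_(A : {set I} | ~~ odd #|A|) \prod_(i in A) y i) *+ 2
    = (\prod_(i | i != i0) (1 + y i)) *+ 2.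
Proof.
move=> y0.
have expand (c : R) :
    \prod_i (c * y i + 1) = \sum_(A : {set I}) c ^+ #|A| * \prod_(i in A) y i.
  rewrite bigA_distr; apply: eq_bigr => A _; rewrite -prodr_const -big_split /=.
  by rewrite [RHS]big_mkcond.
have E1 := expand 1; have EN := expand (-1).
have odd0 : \prod_i (-1 * y i + 1) = 0.
  by rewrite (bigD1 i0) //= y0 mulr1 addNr mul0r.
have -> : (\prod_(i | i != i0) (1 + y i)) *+ 2 = \prod_i (1 * y i + 1).
  rewrite [RHS](bigD1 i0) //= y0 mulr1 mulr2n -[1 + 1]/(2%:R) mulr_natl mulr2n.
  by congr (_ + _); apply: eq_bigr => i _; rewrite mul1r addrC.
rewrite -[RHS]addr0 -[X in _ = _ + X]odd0 E1 EN -big_split /= -sumrMnl [LHS]big_mkcond /=.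
apply: eq_bigr => A _; rewrite expr1n mul1r -signr_odd; case: (odd _) => /=.
  by rewrite expr1 mulN1r subrr.
by rewrite expr0 mul1r mulr2n.
Qed.

(** Allows cancelling the factor 2 in [sum_even_subsets]. *)
Lemma mps_mulrn_inj n d : (0 < d)%N ->
  injective (fun f : {mps int[n]} => f *+ d).
Proof.
move=> d0 f g /= E; apply: mpsP => m.
have coefMn (h : {mps int[n]}) : (h *+ d) m = h m *+ d.
  by elim: (d) => // k IH; rewrite !mulrS mps_coefD IH.
by apply/eqP; rewrite -(eqr_pMn2r d0) -!coefMn E.
Qed.

Lemma sum_I2star_prefix n (s : 'S_n) : (0 < n)%N ->
  \sum_(w in I2star n) \prod_(j in Neg w^-1%g | (j : nat) != 0%N) zprefix s j
    = \prod_(1 <= j < n) (1 + zprefix s j).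
Proof.
case: n s => // n s _.
(* The product omits index 0, so it gets weight 1; this is also what [sum_even_subsets] requires of
   its distinguished index. *)
pose y (j : 'I_n.+1) := if j == ord0 then 1 else zprefix s j.
rewrite (sum_I2star (fun A => \prod_(j in A | (j : nat) != 0%N) zprefix s j)).
apply: (@mps_mulrn_inj _ 2) => //=.
transitivity ((\sum_(A : {set 'I_n.+1} | ~~ odd #|A|) \prod_(i in A) y i) *+ 2).
  congr (_ *+ 2); apply: eq_bigr => A _; rewrite big_mkcondr /=.
  by apply: eq_bigr => j _; rewrite /y -(inj_eq val_inj) /=; case: eqP.
rewrite (@sum_even_subsets _ _ ord0); last by rewrite /y eqxx.
congr (_ *+ 2); rewrite big_mkcond big_ord_recl eqxx /= mul1r.
rewrite big_add1 /= big_mkord; apply: eq_bigr => j _.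
by [].
Qed.

(** * Descents and the decomposition of the box into cones *)

Definition des_count n (s : 'S_n) (k : nat) : nat := \sum_(j in Des s) (k == j.+1).

Lemma des_count0 n (s : 'S_n) : des_count s 0 = 0%N.
Proof. by rewrite /des_count big1. Qed.

Lemma des_countS n (s : 'S_n) (i : 'I_n) : des_count s i.+1 = (i \in Des s).
Proof.
rewrite /des_count big_mkcond (bigD1 i) //= eqxx big1 ?addn0 => [|j /negbTE ji].
  by case: ifP.
by case: ifP => // _; rewrite eqSS eq_sym (inj_eq val_inj) ji.
Qed.

Lemma mem_Des n (s : 'S_n) (i j : 'I_n) :
  j = i.+1 :> nat -> (i \in Des s) = (s j < s i)%N.
Proof.
move=> ij; rewrite inE; apply/existsP/idP => [[k /andP[/eqP ki]]|ji].
  by have -> : k = j by apply: val_inj; rewrite /= ki ij.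
by exists j; rewrite ij eqxx.
Qed.

Lemma last_notin_Des n (s : 'S_n) (i : 'I_n) : i.+1 = n -> (i \in Des s) = false.
Proof.
by move=> E; rewrite inE; apply/existsP => -[j /andP[/eqP]]; have := ltn_ord j; lia.
Qed.

(** Larger exponents come first, and ties are broken by increasing index. *)
Definition decr_rel n (a : 'X_{1..n.+1}) : rel 'I_n := fun i j =>
  (a (lift ord0 j) + (j < i)%N <= a (lift ord0 i))%N.

Lemma decr_rel_total n (a : 'X_{1..n.+1}) : total (decr_rel a).
Proof. move=> i j; rewrite /decr_rel; lia. Qed.

Lemma decr_rel_trans n (a : 'X_{1..n.+1}) : transitive (decr_rel a).
Proof. move=> j i k; rewrite /decr_rel; lia. Qed.

Lemma decr_rel_anti n (a : 'X_{1..n.+1}) : antisymmetric (decr_rel a).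
Proof. move=> i j; rewrite /decr_rel => H; apply: val_inj => /=; lia. Qed.

(** The cone inequalities between positions 1 to [n] are [decr_rel a] on consecutive values of [s],
    a descent being where strictness is imposed. The one at 0 bounds the largest remaining exponent
    by [a ord0], which is the box condition. *)
Lemma cone_Des n (s : 'S_n) (a : 'X_{1..n.+1}) :
  cone s (des_count s) 0 a = sorting_perm (decr_rel a) s && box a.
Proof.
apply/coneP/andP => [C | [/sorting_permP S /forallP B] [_|k kn]] /=.
- have C0 k : (expo s a k <= expo s a 0)%N.
    elim: k => // k; have [kn|nk] := leqP k n; last by rewrite [expo s a k.+1]expo_out // ltnW.
    by have := C k kn; rewrite /=; lia.
  split.
    apply/sorting_permP => i j ij; rewrite /decr_rel -(mem_Des s ij) -des_countS.
    by rewrite -!expoS ij; apply: (C i.+1); rewrite ltn_ord.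
  apply/forallP => i; rewrite -[i](permKV s) -expoS; exact: C0.
- by rewrite des_count0 addn0; case: insub.
- have [kn'|nk] := ltnP k.+1 n.
    rewrite -!/(expo s a _.+1) (expoS s a (Ordinal kn)) (expoS s a (Ordinal kn')).
    rewrite (des_countS s (Ordinal kn)) (@mem_Des _ s _ (Ordinal kn')) //.
    exact: S.
  (* At the last position the next entry is 0 and there is no descent, so nothing is to be
     checked. *)
  rewrite -/(expo s a k.+2) expo_out // (des_countS s (Ordinal kn)).
  by rewrite last_notin_Des //=; apply/eqP; rewrite eqn_leq kn nk.
Qed.

Lemma sum_cone_Des n (a : 'X_{1..n.+1}) :
  \sum_(s : 'S_n) (cone s (des_count s) 0 a)%:R = (box a)%:R :> int.
Proof.
have [s0 sP] := sorting_perm_exists_unique (@decr_rel_total _ a)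
  (@decr_rel_trans _ a) (@decr_rel_anti _ a).
rewrite (bigD1 s0) //= cone_Des sP eqxx big1 ?addr0 // => s /negbTE ne.
by rewrite cone_Des sP ne.
Qed.

(** * Assembly of the identity *)

(** After clearing the denominator, each 1 + x_j with 0 < j < n pairs with 1 - x_j to give 1 -
    x_j^2, and the factors 1 - x_0 and 1 - x_n match. *)
Lemma prefix_sum_cone n (s : 'S_n) : (0 < n)%N ->
  \sum_(w in I2star n)
     ((\prod_(j in Des s) zprefix s j.+1)
      * (\prod_(j in Neg w^-1%g | (j : nat) != 0%N) zprefix s j))
     / ((1 - z0 n) * (1 - zprefix s n)
        * \prod_(1 <= j < n) (1 - zprefix s j ^+ 2))
  = cone_series s (des_count s) 0.
Proof.
move=> n0; rewrite -big_distrl -big_distrr /= sum_I2star_prefix //.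
apply: (mulIr (zdenom_unit s)); rewrite divrK ?zdenom_unit //.
rewrite -cone_series_top -(cone_series_prod _ _ (leqnn _)).
have z00 : zprefix s 0 = z0 n by rewrite /zprefix big_pred0 ?mulr1.
rewrite -mulrA; congr (_ * _).
rewrite -(big_mkord xpredT (fun k => 1 - zprefix s k)) big_nat_recr //=.
rewrite big_ltn // z00 -!mulrA; congr (_ * _).
rewrite mulrCA; congr (_ * _); rewrite -big_split /=; apply: eq_bigr => j _.
by rewrite -subr_sqr expr1n.
Qed.

Theorem theorem7p5 (n : nat) (hn : (2 <= n)%N) :
  mps_sums_to
    (fun k : nat => (\prod_(j < n) qint k.+1 (zvar j)) * z0 n ^+ k)
    (\sum_(s : 'S_n) \sum_(w in I2star n)
       ((\prod_(j in Des s) zprefix s j.+1)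
        * (\prod_(j in Neg w^-1%g | (j : nat) != 0%N) zprefix s j))
       / ((1 - z0 n) * (1 - zprefix s n)
          * \prod_(1 <= j < n) (1 - zprefix s j ^+ 2))).
Proof.
(* Only the term [k = a ord0] can contribute to the coefficient at [a], so the partial sums are
   constant once they include it. *)
move=> a; exists (a ord0).+1 => K aK.
rewrite mps_coef_sum (eq_bigr _ (fun (k : 'I_K) _ => coef_qint_prod k a)).
rewrite (bigD1 (Ordinal aK)) //= eqxx big1 ?addr0.
  rewrite mps_coef_sum -sum_cone_Des; apply: eq_bigr => s _.
  by rewrite prefix_sum_cone // ltnW.
by move=> k; rewrite -(inj_eq val_inj) => /negbTE /= ->.
Qed.
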